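(* If $G$ is a finite, simple, connected graph, then ${\rm mdim}(G)\ge \dim(M(G))$.
   Context: For a connected graph $H$, $d_H$ is the usual distance; for a vertex $v$ and an edge $e=ww'$, $d_H(e,v)=\min\{d_H(w,v),d_H(w',v)\}$. A set $S\subseteq V(H)$ is a resolving set if every two distinct vertices $x,y$ satisfy $d_H(x,v)\ne d_H(y,v)$ for some $v\in S$, and a mixed resolving set if the same holds for every two distinct elements of $V(H)\cup E(H)$; $\dim(H)$ and ${\rm mdim}(H)$ are the minimum cardinalities of a resolving set and of a mixed resolving set. The middle graph $M(G)$ is obtained from $G$ by subdividing each edge $e$ with a new vertex $v_e$ (the original edges being replaced by the two halves), and then joining $v_e$ and $v_f$ whenever the edges $e,f$ of $G$ share an endvertex. *)

(* Defs.v *)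
From mathcomp Require Import all_boot.

Set Implicit Arguments.
Unset Strict Implicit.
Unset Printing Implicit Defensive.

Record sgraph := SGraph {
  svertex :> finType;
  adj : rel svertex;
  adj_sym : symmetric adj;
  adj_irr : irreflexive adj }.

(* The graph with no vertices also satisfies this predicate. *)
Definition connected (G : sgraph) : Prop := forall x y : G, connect (@adj G) x y.

Definition edge_set (G : sgraph) : {set {set G}} :=
  [set [set p.1; p.2] | p : G * G & adj p.1 p.2].

Definition edge (G : sgraph) : finType := {A : {set G} | A \in edge_set G}.

(* Least length of a walk from x to y. Only lengths below #|G| are searched,
   since a shortest walk repeats no vertex; the value is #|G| if y is not
   reachable from x. *)
Definition dist (G : sgraph) (x y : G) : nat :=
  find (fun n => [exists p : n.-tuple G, path (@adj G) x p && (last x p == y)])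
       (iota 0 #|G|).

(* The default #|G| is an upper bound of dist, so it never affects the minimum;
   see edistE. *)
Definition edist (G : sgraph) (e : edge G) (v : G) : nat :=
  \big[minn/#|G|]_(w in val e) dist w v.

Definition element (G : sgraph) : finType := (G + edge G)%type.

Definition eldist (G : sgraph) (a : element G) (v : G) : nat :=
  match a with inl x => dist x v | inr e => edist e v end.

Definition resolving (G : sgraph) (S : {set G}) : bool :=
  [forall x : G, forall y : G,
     (x != y) ==> [exists v in S, dist x v != dist y v]].

Definition mixed_resolving (G : sgraph) (S : {set G}) : bool :=
  [forall a : element G, forall b : element G,
     (a != b) ==> [exists v in S, eldist a v != eldist b v]].

(* In both minima the base point is admissible: see resolvingT and
   mixed_resolvingT. *)
Definition dim (G : sgraph) : nat :=
  #|[arg min_(S < [set: G] | resolving S) #|S|]|.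

Definition mdim (G : sgraph) : nat :=
  #|[arg min_(S < [set: G] | mixed_resolving S) #|S|]|.

Definition middle_adj (G : sgraph) : rel (element G) := fun a b =>
  match a, b with
  | inl _, inl _ => false
  | inl x, inr e => x \in val e
  | inr e, inl x => x \in val e
  | inr e, inr f => (e != f) && (val e :&: val f != set0)
  end.

Lemma middle_adj_sym (G : sgraph) : symmetric (@middle_adj G).
Proof. by move=> [x|e] [y|f] //=; rewrite eq_sym setIC. Qed.

Lemma middle_adj_irr (G : sgraph) : irreflexive (@middle_adj G).
Proof. by move=> [x|e] //=; rewrite eqxx. Qed.

Definition middle (G : sgraph) : sgraph :=
  SGraph (@middle_adj_sym G) (@middle_adj_irr G).

Section Basic.
Variable G : sgraph.
Implicit Types (x y v w : G) (e f : edge G).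

Lemma dist_le x y (p : seq G) :
  path (@adj G) x p -> last x p = y -> dist x y <= size p.
Proof.
move=> xp lp; rewrite /dist; set P := fun n => _.
have Pp : P (size p).
  by apply/existsP; exists (in_tuple p); rewrite xp lp eqxx.
have [szp|szp] := ltnP (size p) #|G|.
  rewrite leqNgt; apply/negP => /(before_find 0).
  by rewrite nth_iota // add0n Pp.
by rewrite (leq_trans (find_size _ _)) ?size_iota.
Qed.

Lemma dist_walk x y : connect (@adj G) x y ->
  exists p : seq G,
    [/\ path (@adj G) x p, last x p = y & size p = dist x y].
Proof.
case/connectP=> p0 /shortenP[p xp up _] lp.
have szp : size (x :: p) <= #|G| by rewrite -(card_uniqP up) max_card.
have dlt : dist x y < #|G| by rewrite (leq_ltn_trans _ szp) ?dist_le.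
move: (dlt); rewrite {1}/dist -[X in _ < X](size_iota 0) -has_find.
move/(nth_find 0); rewrite -/(dist x y) nth_iota // add0n.
case/existsP=> q /andP[xq /eqP lq]; exists q.
by split=> //; rewrite size_tuple.
Qed.

Lemma dist_bound x y : dist x y <= #|G|.
Proof. by rewrite -[X in _ <= X](size_iota 0) find_size. Qed.

Lemma dist_eq0 x y : (dist x y == 0) = (x == y).
Proof.
apply/idP/eqP => [|<-]; last by rewrite -leqn0 (@dist_le x x [::]).
have Gpos : 0 < #|G| by apply/card_gt0P; exists x.
move=> /eqP d0; have : has (fun n => [exists p : n.-tuple G,
  path (@adj G) x p && (last x p == y)]) (iota 0 #|G|).
  by rewrite has_find -/(dist x y) d0 size_iota.
move/(nth_find 0); rewrite -/(dist x y) d0 nth_iota //.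
by case/existsP=> q; rewrite tuple0 => /andP[_ /eqP].
Qed.

Lemma edgeP e : exists w w', adj w w' /\ val e = [set w; w'].
Proof.
by case: e => A /= /imsetP[[w w']]; rewrite inE => ww ->; exists w, w'.
Qed.

Lemma edistE e v w w' :
  val e = [set w; w'] -> edist e v = minn (dist w v) (dist w' v).
Proof.
rewrite /edist => ->; apply/eqP; rewrite eqn_leq; apply/andP; split.
  have le (s : seq G) u : u \in s -> u \in [set w; w'] ->
      \big[minn/#|G|]_(z <- s | z \in [set w; w']) dist z v <= dist u v.
    elim: s => // z s IHs; rewrite inE big_cons => /orP[/eqP <- -> |us uw].
      exact: geq_minl.
    case: ifP => _; last exact: IHs.
    by rewrite (leq_trans (geq_minr _ _)) ?IHs.
  by rewrite leq_min !le ?mem_index_enum ?set21 ?set22.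
elim/big_ind: _ => [|a b|z]; first by rewrite geq_min dist_bound.
  by rewrite leq_min => -> ->.
by rewrite !inE => /orP[]/eqP ->; rewrite ?geq_minl ?geq_minr.
Qed.

Lemma edist_eq0 e v : (edist e v == 0) = (v \in val e).
Proof.
have [w [w' [_ ew]]] := edgeP e.
by rewrite (edistE v ew) ew -leqn0 geq_min !leqn0 !dist_eq0 !inE ![v == _]eq_sym.
Qed.

Lemma resolvingT : resolving [set: G].
Proof.
apply/forallP=> x; apply/forallP=> y; apply/implyP=> nxy.
apply/existsP; exists x; rewrite inE /=; apply/eqP=> dxy.
by move: nxy; rewrite eq_sym -dist_eq0 -dxy dist_eq0 eqxx.
Qed.

Lemma mixed_resolvingT : mixed_resolving [set: G].
Proof.
pose ends (a : element G) := match a with inl x => [set x] | inr e => val e end.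
have ends0 a v : (eldist a v == 0) = (v \in ends a).
  by case: a => [x|e] /=; rewrite ?edist_eq0 // dist_eq0 inE eq_sym.
have ends_inj : injective ends.
  have card2 e : #|val e| = 2.
    have [w [w' [ww ->]]] := edgeP e; rewrite cards2.
    by case: eqP ww => // <-; rewrite adj_irr.
  move=> [x|e] [y|f] /=.
  - by move/set1_inj->.
  - by move/(congr1 (fun A : {set G} => #|A|)); rewrite cards1 card2.
  - by move/(congr1 (fun A : {set G} => #|A|)); rewrite cards1 card2.
  - by move/val_inj->.
apply/forallP=> a; apply/forallP=> b; apply/implyP; apply: contraNT.
rewrite negb_exists => /forallP dab; apply/eqP/ends_inj/setP=> v.
by move: (dab v); rewrite inE /= negbK -!ends0 => /eqP->.
Qed.

End Basic.

(* Main.v *)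
Require Import Defs.
From mathcomp Require Import all_boot.

(** For a vertex [v] of [G] and an element [a] other than [v], the distance from
    [a] to [v] in the middle graph is [eldist a v + 1]: a walk
    [x_0, x_1, ..., x_n] of [G] becomes the walk [x_0, x_0x_1, ..., x_n] of
    [M(G)] through its edges, and one step in [M(G)] changes [eldist _ v] by at
    most 1. Hence a mixed resolving set of [G], regarded as a set of vertices of
    [M(G)], is resolving. *)

Lemma dim_le (G : sgraph) (S : {set G}) : resolving S -> dim G <= #|S|.
Proof.
move=> rS; rewrite /dim; case: arg_minnP; first exact: resolvingT.
by move=> T _; apply.
Qed.

Lemma mdim_witness (G : sgraph) :
  exists2 S : {set G}, mixed_resolving S & #|S| = mdim G.
Proof.
rewrite /mdim; case: arg_minnP; first exact: mixed_resolvingT.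
by move=> T rT _; exists T.
Qed.

Lemma adj_edge (G : sgraph) (x y : G) :
  adj x y -> exists e : edge G, val e = [set x; y].
Proof.
move=> xy; have exy : [set x; y] \in edge_set G.
  by apply/imsetP; exists (x, y); rewrite ?inE.
by exists (exist (fun A : {set G} => A \in edge_set G) _ exy).
Qed.

Lemma edist_le_dist (G : sgraph) (e : edge G) (u v : G) :
  u \in val e -> edist e v <= dist u v.
Proof.
have [w [w' [_ ew]]] := edgeP e.
by rewrite (edistE v ew) ew !inE => /orP[]/eqP->; rewrite ?geq_minl ?geq_minr.
Qed.

Lemma edist_attained (G : sgraph) (e : edge G) (v : G) :
  exists2 u, u \in val e & dist u v = edist e v.
Proof.
have [w [w' [_ ew]]] := edgeP e; rewrite (edistE v ew) ew.
by have [_|_] := leqP (dist w v) (dist w' v); [exists w | exists w'];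
  rewrite ?set21 ?set22.
Qed.

Section Connected.
Variables (G : sgraph) (hG : connected G).

Lemma dist_adj_le (x y v : G) : adj x y -> dist x v <= (dist y v).+1.
Proof.
move=> xy; have [p [yp lp <-]] := dist_walk (hG y v).
by apply: (@dist_le _ _ _ (y :: p)) => //=; rewrite xy.
Qed.

Lemma dist_le_edist (e : edge G) (u v : G) :
  u \in val e -> dist u v <= (edist e v).+1.
Proof.
have [w [w' [ww ew]]] := edgeP e; have w'w := ww; rewrite adj_sym in w'w.
rewrite (edistE v ew) ew -minnSS leq_min !inE.
by case/orP=> /eqP->; rewrite leqnSn dist_adj_le.
Qed.

Lemma eldist_middle_adj (a b : middle G) (v : G) :
  adj a b -> eldist a v <= (eldist b v).+1.
Proof.
case: a b => [x|e] [y|f] //= => [|ye|/andP[_ /set0Pn[u /setIP[ue uf]]]].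
- exact: dist_le_edist.
- exact: leqW (edist_le_dist _ _ _ _ ye).
- exact: leq_trans (edist_le_dist _ _ _ v ue) (dist_le_edist _ _ v uf).
Qed.

(** Each step lowers [eldist _ v] by at most 1, and the step that first enters [inl v] comes from an
    edge at [v], where [eldist] is already 0. That step gains nothing, hence the strict
    inequality. *)
Lemma middle_walk_size (a : middle G) (v : G) (p : seq (middle G)) :
  path (@adj (middle G)) a p -> last a p = inl v -> a != inl v ->
  eldist a v < size p.
Proof.
elim: p a => [|b p IHp] a /=; first by move=> _ ->; rewrite eqxx.
case/andP=> ab bp lp nav; have [bv|nbv] := eqVneq b (inl v).
  move: ab; rewrite {}bv; case: a nav => [x|e] //= _.
  by rewrite -edist_eq0 => /eqP->.
by rewrite ltnS (leq_trans (eldist_middle_adj _ _ v ab)) // IHp.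
Qed.

(** Follow the successive edges of [p], at most one step for each; the extra 1 is the final step
    from an edge down to the end vertex. *)
Lemma middle_walk_edge (u : G) (p : seq G) (e : edge G) :
  path (@adj G) u p -> u \in val e ->
  exists q : seq (middle G),
    [/\ path (@adj (middle G)) (inr e) q, last (inr e) q = inl (last u p)
      & size q <= (size p).+1].
Proof.
elim: p u e => [|y p IHp] u e /=.
  by move=> _ ue; exists [:: inl u]; rewrite /= ue.
case/andP=> /(adj_edge G)[f ef] yp ue.
have yf : y \in val f by rewrite ef set22.
(* If [p] begins by traversing [e] itself, no step is made, as the middle graph has no loops. *)
have [q [fq lq szq]] := IHp _ f yp yf; have [->|nef] := eqVneq e f.
  by exists q; split=> //; apply: leqW.
exists (inr f :: q); split=> //=; rewrite fq nef andbT /=.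
by apply/set0Pn; exists u; rewrite inE ue ef set21.
Qed.

Lemma middle_walk (a : middle G) (v : G) : a != inl v ->
  exists q : seq (middle G),
    [/\ path (@adj (middle G)) a q, last a q = inl v
      & size q <= (eldist a v).+1].
Proof.
case: a => [x|e] nav /=.
  have [p [xp lp <-]] := dist_walk (hG x v).
  case: p xp lp => [_ /= xv|y p /= /andP[/(adj_edge G)[f ef] yp] lp].
    by rewrite xv eqxx in nav.
  have yf : y \in val f by rewrite ef set22.
  (* Continuing from the far end [y] of the first edge saves the step that was spent on going from
     [x] to [f]. *)
  have [q [fq lq szq]] := middle_walk_edge _ _ _ yp yf.
  by exists (inr f :: q); rewrite /= fq lq lp ltnS szq ef set21.
have [u ue <-] := edist_attained _ e v.
have [p [up lp <-]] := dist_walk (hG u v).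
by rewrite -lp; apply: middle_walk_edge.
Qed.

Lemma dist_middle (a : middle G) (v : G) : a != inl v ->
  dist a (inl v : middle G) = (eldist a v).+1.
Proof.
move=> nav; have [q [aq lq szq]] := middle_walk _ _ nav.
apply/eqP; rewrite eqn_leq (leq_trans (dist_le aq lq) szq) /=.
(* Reachability makes [dist] the length of an actual walk, not the default value. *)
have /dist_walk[p [ap lp <-]] : connect (@adj (middle G)) a (inl v).
  by apply/connectP; exists q.
exact: middle_walk_size.
Qed.

Lemma resolving_middle (S : {set G}) :
  mixed_resolving S -> @resolving (middle G) [set inl v | v in S].
Proof.
move=> /forallP rS; apply/forallP=> a; apply/forallP=> b; apply/implyP=> nab.
have /forallP/(_ b)/implyP/(_ nab)/existsP[v /andP[vS dv]] := rS a.
apply/existsP; exists (inl v); rewrite imset_f //=.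
(* The distance formula fails at [inl v] itself, but there the distance is 0, and it is positive
   from the other element. *)
have [av|nav] := eqVneq a (inl v).
  rewrite av (eqP (_ : dist _ _ == 0)) ?dist_eq0 //.
  by rewrite eq_sym dist_eq0 -av eq_sym.
have [bv|nbv] := eqVneq b (inl v).
  by rewrite bv [X in _ != X](eqP (_ : dist _ _ == 0)) dist_eq0.
by rewrite !dist_middle.
Qed.

End Connected.

Theorem theorem4p1 (G : sgraph) (hG : connected G) : dim (middle G) <= mdim G.
Proof.
have [S rS <-] := mdim_witness G.
exact: leq_trans (dim_le _ _ (resolving_middle _ hG _ rS)) (leq_imset_card _ _).
Qed.
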